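(* Let $k\in\{1,2,3\}$, $\delta t>0$ and let $N$ be a positive integer. Let $(\bar\phi_N^{n+1},\bar u_N^{n+1},\bar q_N^{n+1})$ and $(\phi_N^n,u_N^n,q_N^n)$, $n\ge0$, be generated by the fully discrete Fourier spectral scheme described in the context, started from $q_N^0=E(\phi_N^0,u_N^0)$. Then the scheme satisfies the energy dissipation law $$q_N^{n+1}\le q_N^n\qquad\text{for all } n\ge0 .$$ In addition, the quantities $\|\nabla\phi_N^n\|_0$ and $\|u_N^n\|_0$ remain bounded for all $n$, i.e. there is a constant $C$, independent of $n$ and of the time step size $\delta t$, such that $\|\nabla\phi_N^n\|_0\le C$ and $\|u_N^n\|_0\le C$ for all $n$.
   Context: **Setting.** $\Omega=(0,2\pi)^2$ with periodic boundary conditions. $\|\cdot\|_0$ is the $L^2(\Omega)$ norm. $\tau,\varepsilon,\lambda,K,D,S_1,S_2$ are positive constants. $F(\phi)=\frac{1}{4\varepsilon^2}(\phi^2-1)^2$ and $f=F'$. **Anisotropic coefficient.** $m(\nabla\phi)=1+\sigma\cos(\beta\theta)$, where $\sigma\in[0,1)$ is the anisotropy strength, the positive integer $\beta$ is the number of folds, and $\theta$ is the angle of the direction of $\nabla\phi$ ($\theta=\arctan(\phi_y/\phi_x)$). For $\beta=4$ this is $m(\nabla\phi)=1-3\sigma+4\sigma\frac{\phi_x^4+\phi_y^4}{|\nabla\phi|^4}$. $\boldsymbol H(\phi)$ denotes the derivative of $m$ with respect to its vector argument, evaluated at $\nabla\phi$. The expressions $m(\nabla\phi)\nabla\phi$,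 $m^2(\nabla\phi)\nabla\phi$ and $|\nabla\phi|^2m(\nabla\phi)\boldsymbol H(\phi)$ are taken to be $0$ where $\nabla\phi=0$. **Energy and related quantities.** $$E(\phi,u)=\int_\Omega\Big(\tfrac12|m(\nabla\phi)\nabla\phi|^2+\tfrac{\lambda}{2\varepsilon K}u^2+F(\phi)\Big)d\mathbf{x}+1,$$ $$\frac{\delta E}{\delta\phi}=-\nabla\cdot\big(m^2(\nabla\phi)\nabla\phi+|\nabla\phi|^2m(\nabla\phi)\boldsymbol H(\phi)\big)+f(\phi),$$ $$\frac{\delta E_1}{\delta\phi}=\frac{\delta E}{\delta\phi}+S_1\Delta\phi-\frac{S_2}{\varepsilon^2}\phi,$$ $$\mathcal H(\phi,u)=\frac1\tau\Big\|\frac{\delta E}{\delta\phi}+4\lambda\varepsilon F(\phi)u\Big\|_0^2+\frac{\lambda D}{\varepsilon K}\|\nabla u\|_0^2 .$$ $\frac{\delta E_1}{\delta\phi}(v)$ denotes this expression with $\phi$ replaced by $v$. **BDF-$k$ notation.** For a sequence $\varphi^n$: - $k=1$: $\alpha_1=1$, $A_1(\varphi^n)=\varphi^n$, $B_1(\varphi^n)=\varphi^n$. - $k=2$: $\alpha_2=\frac32$, $A_2(\varphi^n)=2\varphi^n-\frac12\varphi^{n-1}$, $B_2(\varphi^n)=2\varphi^n-\varphi^{n-1}$. - $k=3$: $\alpha_3=\frac{11}{6}$, $A_3(\varphi^n)=3\varphi^n-\frac32\varphi^{n-1}+\frac13\varphi^{n-2}$, $B_3(\varphi^n)=3\varphi^n-3\varphi^{n-1}+\varphi^{n-2}$.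 **Fully discrete scheme.** The starting values $\phi_N^{-j},u_N^{-j}$, $0\le j\le k-1$, are given real-valued trigonometric polynomials with modes $\mathbf k=(k_1,k_2)$, $-N\le k_1,k_2\le N$, and $q_N^0=E(\phi_N^0,u_N^0)$. Write $\{g\}_{\mathbf k}$ for the $\mathbf k$-th Fourier mode (coefficient of $\exp(-\mathrm i\,\mathbf k\cdot\mathbf x)$) of $g$. For each $n\ge0$: *Step 1.* Set $$\bar\phi_N^{n+1}(\mathbf x)=\sum_{k_1,k_2=-N}^N\hat\phi_{\mathbf k}^{n+1}\exp(-\mathrm i\,\mathbf k\cdot\mathbf x),\qquad \bar u_N^{n+1}(\mathbf x)=\sum_{k_1,k_2=-N}^N\hat u_{\mathbf k}^{n+1}\exp(-\mathrm i\,\mathbf k\cdot\mathbf x),$$ where, for all $-N\le k_1,k_2\le N$, $$\Big(\tau\frac{\alpha_k}{\delta t}+\frac{S_2}{\varepsilon^2}+S_1|\mathbf k|^2\Big)\hat\phi_{\mathbf k}^{n+1}=\Big\{\frac{\tau}{\delta t}A_k(\phi_N^n)-\frac{\delta E_1}{\delta\phi}(B_k(\phi_N^n))-4\lambda\varepsilon F(B_k(\phi_N^n))B_k(u_N^n)\Big\}_{\mathbf k},$$ $$\Big(\frac{\alpha_k}{\delta t}+D|\mathbf k|^2\Big)\hat u_{\mathbf k}^{n+1}=\Big\{\frac{1}{\delta t}A_k(u_N^n)+4\varepsilon^2KF(B_k(\phi_N^n))\frac{\alpha_k\bar\phi_N^{n+1}-A_k(\phi_N^n)}{\delta t}\Big\}_{\mathbf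 k}.$$ (The subscript $k$ in $\alpha_k,A_k,B_k$ is the BDF order; $\mathbf k$ is the wave vector.) Compute $\bar q_N^{n+1}$ from $$\frac{1}{\delta t}(\bar q_N^{n+1}-q_N^n)=-\frac{\bar q_N^{n+1}}{E(\bar\phi_N^{n+1},\bar u_N^{n+1})}\mathcal H(\bar\phi_N^{n+1},\bar u_N^{n+1}).$$ *Step 2.* Set $$\xi_k^{n+1}=\frac{\bar q_N^{n+1}}{E(\bar\phi_N^{n+1},\bar u_N^{n+1})},\qquad \eta_k^{n+1}=1-(1-\xi_k^{n+1})^{k+1},$$ $$\phi_N^{n+1}=\eta_k^{n+1}\bar\phi_N^{n+1},\qquad u_N^{n+1}=\eta_k^{n+1}\bar u_N^{n+1},$$ $$q_N^{n+1}=\zeta^{n+1}\bar q_N^{n+1}+(1-\zeta^{n+1})E(\phi_N^{n+1},u_N^{n+1}),$$ where $\zeta^{n+1}\in[0,1]$ is chosen such that $$\frac{q_N^{n+1}-\bar q_N^{n+1}}{\delta t}\le\frac{\bar q_N^{n+1}}{E(\bar\phi_N^{n+1},\bar u_N^{n+1})}\mathcal H(\bar\phi_N^{n+1},\bar u_N^{n+1}).$$ *)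

(* Defs.v *)
From HB Require Import structures.
From mathcomp Require Import all_boot all_order all_algebra.
From mathcomp Require Import complex.
From mathcomp Require Import all_classical all_reals all_analysis.

Set Implicit Arguments.
Unset Strict Implicit.
Unset Printing Implicit Defensive.

Import Order.TTheory GRing.Theory Num.Theory.
Import numFieldNormedType.Exports.

Local Open Scope classical_set_scope.
Local Open Scope ring_scope.

Record model (R : realType) := Model {
  tau : R;
  eps : R;
  lam : R;
  Kc : R;
  Dc : R;
  S1 : R;
  S2 : R;
  sigma : R;
  beta : nat;
  tau_gt0 : 0 < tau;
  eps_gt0 : 0 < eps;
  lam_gt0 : 0 < lam;
  Kc_gt0 : 0 < Kc;
  Dc_gt0 : 0 < Dc;
  S1_gt0 : 0 < S1;
  S2_gt0 : 0 < S2;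
  sigma_ge0 : 0 <= sigma;
  sigma_lt1 : sigma < 1;
  beta_gt0 : (0 < beta)%N
}.

Section calculus.
Context {R : realType}.
Implicit Types (g : R * R -> R) (p x : R * R).

Definition Omega : set (R * R) :=
  `]0, 2 * pi[%classic `*` `]0, 2 * pi[%classic.

Definition integralO g : R :=
  \int[(@lebesgue_measure R \x @lebesgue_measure R)%E]_(x in Omega) g x.

Definition normL2 g : R := Num.sqrt (integralO (fun x => g x ^+ 2)).

(* The norm that the library puts on R * R is the max norm. *)
Definition enorm p : R := Num.sqrt (p.1 ^+ 2 + p.2 ^+ 2).

(* The L^2 norm of a vector field is that of its pointwise Euclidean length. *)
Definition normL2v (G : R * R -> R * R) : R := normL2 (enorm \o G).

Definition dx g x : R := 'D_((1, 0) : R * R) g x.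
Definition dy g x : R := 'D_((0, 1) : R * R) g x.
Definition grad g x : R * R := (dx g x, dy g x).
Definition div (G : R * R -> R * R) x : R := dx (fst \o G) x + dy (snd \o G) x.
Definition laplacian g : R * R -> R := div (grad g).

(* Polar angle in ]-pi, pi].  The formula arctan (p.2 / p.1) determines the
   direction of p only modulo pi, which does not change cos (beta * theta) for
   even beta, but does for odd beta. *)
Definition angle p : R :=
  if 0 <= p.2 then acos (p.1 / enorm p) else - acos (p.1 / enorm p).

End calculus.

Section model_functionals.
Context {R : realType} (M : model R).
Implicit Types (phi u : R * R -> R) (p x : R * R).

Definition F (s : R) : R := (s ^+ 2 - 1) ^+ 2 / (4 * eps M ^+ 2).
Definition f : R -> R := derive1 F.

Definition m p : R := 1 + sigma M * cos ((beta M)%:R * angle p).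

(* m p *: p, and flux p below, vanish at p = 0 whatever m 0 and grad m 0 are. *)
Definition flux p : R * R :=
  (m p ^+ 2 * p.1 + enorm p ^+ 2 * m p * (grad m p).1,
   m p ^+ 2 * p.2 + enorm p ^+ 2 * m p * (grad m p).2).

Definition energy phi u : R :=
  integralO (fun x =>
    2^-1 * enorm (m (grad phi x) *: grad phi x) ^+ 2
    + lam M / (2 * eps M * Kc M) * u x ^+ 2 + F (phi x)) + 1.

(* flux \o grad phi is Lipschitz when phi is a trigonometric polynomial, so its
   divergence exists almost everywhere; it is only used under an integral. *)
Definition dE phi x : R := - div (flux \o grad phi) x + f (phi x).

Definition dE1 phi x : R :=
  dE phi x + S1 M * laplacian phi x - S2 M / eps M ^+ 2 * phi x.

Definition dissipation phi u : R :=
  (tau M)^-1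
    * normL2 (fun x => dE phi x + 4 * lam M * eps M * F (phi x) * u x) ^+ 2
  + lam M * Dc M / (eps M * Kc M) * normL2v (grad u) ^+ 2.

End model_functionals.

Section fourier.
Context {R : realType}.
Local Open Scope complex_scope.
Implicit Types (g : R * R -> R) (c : int -> int -> R[i]).

Definition wave (k1 k2 : int) (x : R * R) : R := k1%:~R * x.1 + k2%:~R * x.2.
Definition wave_sq (k1 k2 : int) : R := k1%:~R ^+ 2 + k2%:~R ^+ 2.

Definition expi (t : R) : R[i] := cos t +i* sin t.

Definition trig_sum (N : nat) c (x : R * R) : R[i] :=
  \sum_(i < (2 * N).+1) \sum_(j < (2 * N).+1)
    c (i%:Z - N%:Z) (j%:Z - N%:Z)
      * expi (- wave (i%:Z - N%:Z) (j%:Z - N%:Z) x).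

(* Coefficients produced by the scheme satisfy c (- k) = (c k)^* because they
   come from modes of real-valued functions, so asking for a real sum is not an
   extra constraint there. *)
Definition has_coefs (N : nat) g c : Prop :=
  forall x, (g x)%:C = trig_sum N c x.

Definition trig_poly (N : nat) g : Prop := exists c, has_coefs N g c.

(* Coefficient of exp (- i k.x): the mean over Omega of g * exp (i k.x), by
   real and imaginary parts since g is real-valued. *)
Definition mode g (k1 k2 : int) : R[i] :=
  ((2 * pi) ^- 2 * integralO (fun x => g x * cos (wave k1 k2 x)))
  +i* ((2 * pi) ^- 2 * integralO (fun x => g x * sin (wave k1 k2 x))).

End fourier.

(* For these three, k is meant to be 1, 2 or 3; the last branch is k = 3. *)
Section bdf.
Context {R : realType}.
Implicit Types (k : nat) (v : int -> R * R -> R) (n : int).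

Definition alpha k : R :=
  match k with 1 => 1 | 2 => 3 / 2 | _ => 11 / 6 end.

Definition bdfA k v n (x : R * R) : R :=
  match k with
  | 1 => v n x
  | 2 => 2 * v n x - 1 / 2 * v (n - 1) x
  | _ => 3 * v n x - 3 / 2 * v (n - 1) x + 1 / 3 * v (n - 2) x
  end.

Definition bdfB k v n (x : R * R) : R :=
  match k with
  | 1 => v n x
  | 2 => 2 * v n x - v (n - 1) x
  | _ => 3 * v n x - 3 * v (n - 1) x + v (n - 2) x
  end.

End bdf.

(* phi_ and u_ carry the starting values at the indices 0, -1, .., 1 - k.  The
   barred quantities, their Fourier coefficients and zeta_ are only meaningful
   from index 1 on. *)
Record iterates (R : realType) := Iterates {
  phi_ : int -> R * R -> R;
  u_ : int -> R * R -> R;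
  q_ : nat -> R;
  phibar : nat -> R * R -> R;
  ubar : nat -> R * R -> R;
  qbar : nat -> R;
  phihat : nat -> int -> int -> R[i];
  uhat : nat -> int -> int -> R[i];
  zeta_ : nat -> R
}.

Section scheme.
Context {R : realType} (M : model R) (k N : nat) (dt : R) (s : iterates R).
Local Open Scope complex_scope.

Definition starting_values : Prop :=
  (forall j : nat, (j < k)%N ->
     trig_poly N (phi_ s (- j%:Z)) /\ trig_poly N (u_ s (- j%:Z)))
  /\ q_ s 0 = energy M (phi_ s 0) (u_ s 0).

Definition in_range (l : int) : bool := (- N%:Z <= l) && (l <= N%:Z).

Definition phi_equation (n : nat) : Prop :=
  has_coefs N (phibar s n.+1) (phihat s n.+1) /\
  forall k1 k2 : int, in_range k1 -> in_range k2 ->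
    (tau M * (alpha k / dt) + S2 M / eps M ^+ 2 + S1 M * wave_sq k1 k2)%:C
      * phihat s n.+1 k1 k2
    = mode (fun x =>
        tau M / dt * bdfA k (phi_ s) n x
        - dE1 M (bdfB k (phi_ s) n) x
        - 4 * lam M * eps M * F M (bdfB k (phi_ s) n x) * bdfB k (u_ s) n x)
        k1 k2.

Definition u_equation (n : nat) : Prop :=
  has_coefs N (ubar s n.+1) (uhat s n.+1) /\
  forall k1 k2 : int, in_range k1 -> in_range k2 ->
    (alpha k / dt + Dc M * wave_sq k1 k2)%:C * uhat s n.+1 k1 k2
    = mode (fun x =>
        dt^-1 * bdfA k (u_ s) n x
        + 4 * eps M ^+ 2 * Kc M * F M (bdfB k (phi_ s) n x)
          * ((alpha k * phibar s n.+1 x - bdfA k (phi_ s) n x) / dt))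
        k1 k2.

Definition energy_bar (n : nat) : R := energy M (phibar s n) (ubar s n).
Definition dissipation_bar (n : nat) : R := dissipation M (phibar s n) (ubar s n).

Definition q_equation (n : nat) : Prop :=
  dt^-1 * (qbar s n.+1 - q_ s n)
  = - (qbar s n.+1 / energy_bar n.+1) * dissipation_bar n.+1.

Definition xi (n : nat) : R := qbar s n / energy_bar n.
Definition eta (n : nat) : R := 1 - (1 - xi n) ^+ k.+1.

Definition correction (n : nat) : Prop :=
  [/\ forall x, phi_ s n.+1%:Z x = eta n.+1 * phibar s n.+1 x,
      forall x, u_ s n.+1%:Z x = eta n.+1 * ubar s n.+1 x,
      q_ s n.+1 = zeta_ s n.+1 * qbar s n.+1
        + (1 - zeta_ s n.+1) * energy M (phi_ s n.+1%:Z) (u_ s n.+1%:Z),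
      0 <= zeta_ s n.+1 <= 1 &
      (q_ s n.+1 - qbar s n.+1) / dt
        <= qbar s n.+1 / energy_bar n.+1 * dissipation_bar n.+1].

Definition scheme : Prop :=
  starting_values /\
  forall n : nat,
    [/\ phi_equation n, u_equation n, q_equation n & correction n].

End scheme.

(* Main.v *)
Require Import Defs.
From mathcomp Require Import all_boot all_order all_algebra.
From mathcomp Require Import complex ring lra.
From mathcomp Require Import all_classical all_reals all_analysis.
From mathcomp Require Import measurable_realfun.
Import Order.TTheory GRing.Theory Num.Theory.
Import numFieldNormedType.Exports.
Local Open Scope classical_set_scope.
Local Open Scope ring_scope.

(* The equation for qbar and the condition on zeta add up to [q n.+1 <= q n], and
   [qbar * (1 + dt * H / E) = q] with [E >= 1], [H >= 0] propagates [0 <= q].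
   Hence [0 <= xi <= q 0 / E]; as [eta = 1 - (1 - xi)^(k+1)] is divisible by xi,
   this gives [|eta| <= A / E] with A depending on k and [q 0] only.  Since the
   squared norms of [grad phibar] and [ubar] are at most a multiple of E, those
   of [eta * grad phibar] and [eta * ubar] are at most a multiple of [A^2 / E],
   and E cancels because [E >= 1].  The iterates being trigonometric
   polynomials, every integrand is bounded and measurable, so that the integrals
   can be compared. *)

(** * Integration over [Omega] of bounded measurable functions *)

Section bounded_measurable.
Context {R : realType}.
Implicit Types (g h : R * R -> R) (n : nat).

(** The bound is asked on the whole plane: trigonometric polynomials satisfy it, the class is an
    algebra, and on [Omega], which has finite measure, it yields integrability. *)
Definition bounded_measurable g : Prop :=
  measurable_fun [set: measurableTypeR R * measurableTypeR R] g /\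
  exists B : R, forall x, `|g x| <= B.

Lemma bounded_measurable_cst (c : R) : bounded_measurable (fun=> c).
Proof. by split; [exact: measurable_cst|exists `|c|]. Qed.

Lemma bounded_measurableD {g h} : bounded_measurable g ->
  bounded_measurable h -> bounded_measurable (fun x => g x + h x).
Proof.
move=> [mg [B gB]] [mh [C hC]]; split; first exact: measurable_funD.
by exists (B + C) => x; rewrite (le_trans (ler_normD _ _))// lerD.
Qed.

Lemma bounded_measurableM {g h} : bounded_measurable g ->
  bounded_measurable h -> bounded_measurable (fun x => g x * h x).
Proof.
move=> [mg [B gB]] [mh [C hC]]; split; first exact: measurable_funM.
by exists (B * C) => x; rewrite normrM ler_pM.
Qed.

Lemma bounded_measurableZ (c : R) {g} :
  bounded_measurable g -> bounded_measurable (fun x => c * g x).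
Proof.
by move=> bg; apply: bounded_measurableM => //; exact: bounded_measurable_cst.
Qed.

Lemma bounded_measurableX {g} n :
  bounded_measurable g -> bounded_measurable (fun x => g x ^+ n).
Proof.
move=> bg; elim: n => [|n IH]; first exact: bounded_measurable_cst.
rewrite (_ : (fun _ => _) = fun x => g x * g x ^+ n).
  exact: bounded_measurableM.
by apply/funext => x; rewrite exprS.
Qed.

Lemma measurable_Omega :
  measurable (@Omega R : set (measurableTypeR R * measurableTypeR R)).
Proof. by apply: measurableX; exact: measurable_itv. Qed.

Lemma bounded_measurable_integrable {g} : bounded_measurable g ->
  ((@lebesgue_measure R) \x (@lebesgue_measure R))%E.-integrable Omega
    (EFin \o g).
Proof.
move=> [mg [B gB]]; apply: measurable_bounded_integrable.
- exact: measurable_Omega.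
(* Both branches of the length formula are finite; the measure of the square is the product of two
   such lengths. *)
- have finI : (@lebesgue_measure R `]0%R, (2 * pi)%R[%classic < +oo)%E.
    by rewrite lebesgue_measure_itv/=; case: ifP => _; rewrite -?EFinD ltry.
  have E := @product_measure1E _ _ _ _ R (@lebesgue_measure R)
    (@lebesgue_measure R) _ _ (@measurable_itv R `]0, (2 * pi)[)
    (@measurable_itv R `]0, (2 * pi)[).
  apply: (@eq_ind _ _ (fun z => (z < +oo)%E) _ _ (esym E)).
  by apply: lte_mul_pinfty => //; rewrite ge0_fin_numE.
- exact: measurable_funTS.
- exists B; split; first exact: num_real.
  by move=> y By x _ /=; rewrite (le_trans (gB x))// ltW.
Qed.

Lemma integralO_le g h : bounded_measurable g -> bounded_measurable h ->
  (forall x, g x <= h x) -> integralO g <= integralO h.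
Proof.
move=> bg bh gh; apply: le_Rintegral => //.
- exact: measurable_Omega.
- exact: bounded_measurable_integrable.
- exact: bounded_measurable_integrable.
Qed.

Lemma integralOZ (c : R) g : bounded_measurable g ->
  integralO (fun x => c * g x) = c * integralO g.
Proof.
move=> bg; apply: RintegralZl; first exact: measurable_Omega.
exact: bounded_measurable_integrable.
Qed.

Lemma integralO_ge0 g : (forall x, 0 <= g x) -> 0 <= integralO g.
Proof. by move=> g0; apply: Rintegral_ge0. Qed.

End bounded_measurable.

(** * Regularity of trigonometric polynomials *)

Section trigonometric.
Context {R : realType}.
Implicit Types (g h gx gy : R * R -> R) (k l : int).

(** Only the two directional derivatives that [grad] reads are recorded, with explicit witnesses, so
    that sums and multiples are handled by the rules for [is_derive]. *)
Definition bounded_partials g : Prop :=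
  exists gx gy, [/\ bounded_measurable g, bounded_measurable gx,
    bounded_measurable gy,
    forall x, is_derive x ((1, 0) : R * R) g (gx x) &
    forall x, is_derive x ((0, 1) : R * R) g (gy x)].

Lemma bounded_partials_grad g : bounded_partials g ->
  bounded_measurable (dx g) /\ bounded_measurable (dy g).
Proof.
move=> [gx [gy [_ bgx bgy Dx Dy]]]; split.
- by rewrite (_ : dx g = gx)//; apply/funext => x; rewrite /dx derive_val.
- by rewrite (_ : dy g = gy)//; apply/funext => x; rewrite /dy derive_val.
Qed.

Lemma bounded_partials_cst (c : R) : bounded_partials (fun=> c).
Proof.
exists (fun=> 0), (fun=> 0).
by split; [exact: bounded_measurable_cst..| |] => x; exact: is_derive_cst.
Qed.

Lemma bounded_partialsD {g h} : bounded_partials g -> bounded_partials h ->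
  bounded_partials (fun x => g x + h x).
Proof.
move=> [gx [gy [bg bgx bgy gDx gDy]]] [hx [hy [bh bhx bhy hDx hDy]]].
exists (fun x => gx x + hx x), (fun x => gy x + hy x).
by split; [exact: bounded_measurableD..| |] => x; exact: is_deriveD.
Qed.

Lemma bounded_partialsZ (c : R) {g} : bounded_partials g ->
  bounded_partials (fun x => c * g x).
Proof.
move=> [gx [gy [bg bgx bgy gDx gDy]]].
exists (fun x => c * gx x), (fun x => c * gy x).
by split; [exact: bounded_measurableZ..| |] => x; exact: is_deriveZ.
Qed.

Lemma grad_scale (c : R) g : bounded_partials g ->
  grad (fun x => c * g x) = fun x => (c * dx g x, c * dy g x).
Proof.
move=> [gx [gy [_ _ _ gDx gDy]]]; apply/funext => x.
by rewrite /grad /dx /dy !deriveZ.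
Qed.

Lemma bounded_partials_sum (I : Type) (r : seq I) (G : I -> R * R -> R) :
  (forall i, bounded_partials (G i)) ->
  bounded_partials (fun x => \sum_(i <- r) G i x).
Proof.
move=> bG; elim: r => [|i r IH].
  rewrite (_ : (fun _ => _) = fun=> 0); first exact: bounded_partials_cst.
  by apply/funext => x; rewrite big_nil.
rewrite (_ : (fun _ => _) = fun x => G i x + \sum_(j <- r) G j x).
  exact: bounded_partialsD.
by apply/funext => x; rewrite big_cons.
Qed.

Lemma measurable_wave (k l : int) :
  measurable_fun [set: measurableTypeR R * measurableTypeR R] (wave k l).
Proof.
apply: measurable_funD; apply: measurable_funM; try exact: measurable_cst.
- exact: measurable_fst.
- exact: measurable_snd.
Qed.

(* Along a line, the wave is affine, so the directional derivative reduces to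
   one variable. *)
Lemma is_derive_wave (f f' : R -> R) k l (x v : R * R) :
  (forall t : R, is_derive t (1 : R) f (f' t)) ->
  is_derive x v (f \o wave k l) (wave k l v * f' (wave k l x)).
Proof.
move=> Df.
pose a (t : R) := wave k l v * t + wave k l x.
have a0 : a 0 = wave k l x by rewrite /a mulr0 add0r.
have Da : is_derive (0 : R) 1 (f \o a) (f' (a 0) * wave k l v).
  apply: is_derive1_comp; rewrite /a.
  by apply: is_derive_eq; rewrite addr0 /GRing.scale/= mulr1.
(* The wave is linear, so the two difference quotients agree for every [h]; this transfers both the
   existence of the limit and its value. *)
have E : (fun h : R => h^-1 *:
      (((f \o wave k l) \o shift x) (h *: v) - (f \o wave k l) x)) =
    (fun h : R => h^-1 *: (((f \o a) \o shift 0) (h *: (1 : R)) - (f \o a) 0)).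
  apply/funext => h; rewrite /= a0 /a addr0 /GRing.scale/= mulr1.
  congr (_ * (f _ - _)); rewrite /wave/= -![h *: _]/(h * _); ring.
case: Da => ca da; rewrite a0 mulrC in da.
split.
- by move: ca; rewrite /derivable E.
- by rewrite -da /derive E.
Qed.

Lemma bounded_measurable_cos_wave (k l : int) :
  bounded_measurable (fun x : R * R => cos (wave k l x)).
Proof.
split; last by exists 1 => x; rewrite ler_norml cos_geN1 cos_le1.
apply: (measurableT_comp _ (measurable_wave k l)).
apply: continuous_measurable_fun; exact: continuous_cos.
Qed.

Lemma bounded_measurable_sin_wave (k l : int) :
  bounded_measurable (fun x : R * R => sin (wave k l x)).
Proof.
split; last by exists 1 => x; rewrite ler_norml sin_geN1 sin_le1.
apply: (measurableT_comp _ (measurable_wave k l)).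
apply: continuous_measurable_fun; exact: continuous_sin.
Qed.

Lemma bounded_partials_cos_wave (k l : int) :
  bounded_partials (fun x : R * R => cos (wave k l x)).
Proof.
exists (fun x => wave k l ((1, 0) : R * R) * - sin (wave k l x)).
exists (fun x => wave k l ((0, 1) : R * R) * - sin (wave k l x)).
have bs := bounded_measurable_sin_wave k l.
have bNs : bounded_measurable (fun x : R * R => - sin (wave k l x)).
  rewrite (_ : (fun _ => _) = fun x => -1 * sin (wave k l x)).
    exact: bounded_measurableZ.
  by apply/funext => x; rewrite mulN1r.
split;
  [exact: bounded_measurable_cos_wave|exact: bounded_measurableZ..| |] => x;
  exact: (@is_derive_wave (@cos R) (fun t => - sin t)).
Qed.

Lemma bounded_partials_sin_wave (k l : int) :
  bounded_partials (fun x : R * R => sin (wave k l x)).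
Proof.
exists (fun x => wave k l ((1, 0) : R * R) * cos (wave k l x)).
exists (fun x => wave k l ((0, 1) : R * R) * cos (wave k l x)).
have bc := bounded_measurable_cos_wave k l.
split;
  [exact: bounded_measurable_sin_wave|exact: bounded_measurableZ..| |] => x;
  exact: (@is_derive_wave (@sin R) cos).
Qed.

Lemma Re_sum (I : Type) (r : seq I) (G : I -> R[i]%C) :
  complex.Re (\sum_(i <- r) G i) = \sum_(i <- r) complex.Re (G i).
Proof.
elim: r => [|i r IH]; first by rewrite !big_nil.
by rewrite !big_cons -IH; case: (G i) => a b; case: (\sum_(_ <- _) _).
Qed.

(** As [g] is real, it equals the real part of its Fourier sum. The real part of [(a + ib) exp(-iw)]
    is [a cos w + b sin w], which leaves a finite combination of cosines and sines of waves. *)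
Lemma has_coefs_bounded_partials N g c : has_coefs N g c -> bounded_partials g.
Proof.
move=> gc.
have -> : g = fun x =>
  \sum_(i < (2 * N).+1) \sum_(j < (2 * N).+1)
    (complex.Re (c (i%:Z - N%:Z) (j%:Z - N%:Z))
       * cos (wave (i%:Z - N%:Z) (j%:Z - N%:Z) x)
   + complex.Im (c (i%:Z - N%:Z) (j%:Z - N%:Z))
       * sin (wave (i%:Z - N%:Z) (j%:Z - N%:Z) x)).
  apply/funext => x; have /(congr1 (@complex.Re R)) := gc x; rewrite /= => ->.
  rewrite /trig_sum Re_sum; apply: eq_bigr => i _.
  rewrite Re_sum; apply: eq_bigr => j _.
  by case: (c _ _) => a b; rewrite /expi cosN sinN /= mulrN opprK.
apply: bounded_partials_sum => i; apply: bounded_partials_sum => j.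
by apply: bounded_partialsD; apply: bounded_partialsZ;
  [exact: bounded_partials_cos_wave|exact: bounded_partials_sin_wave].
Qed.

End trigonometric.

(** * Measurability and coercivity of the energy density *)

Section energy_bounds.
Context {R : realType} (M : model R).
Implicit Types (g h gx gy phi u : R * R -> R) (p : R * R) (n : nat).

Lemma enorm_sq p : enorm p ^+ 2 = p.1 ^+ 2 + p.2 ^+ 2.
Proof. by rewrite sqr_sqrtr// addr_ge0// sqr_ge0. Qed.

Lemma direction_cosine_itv p : p.1 / enorm p \in `[-1, 1].
Proof.
have n0 : 0 <= enorm p by exact: sqrtr_ge0.
rewrite in_itv/= -ler_norml normrM normfV (ger0_norm n0).
(* At the origin the inverse of 0 is 0, so the quotient is 0 and stays in the interval. *)
have [->|nz] := eqVneq (enorm p) 0; first by rewrite invr0 mulr0.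
rewrite ler_pdivrMr ?lt0r ?nz// mul1r -sqrtr_sqr ler_wsqrtr//.
by rewrite lerDl sqr_ge0.
Qed.

(** Cosine is even, so the sign of the angle in the lower half plane drops out and [m] becomes a
    Chebyshev polynomial of the direction cosine. *)
Lemma mE p : m M p = 1 + sigma M * cos ((beta M)%:R * acos (p.1 / enorm p)).
Proof. by rewrite /m /angle; case: ifP => // _; rewrite mulrN cosN. Qed.

(** The lower bound is positive since [sigma < 1]; this is the source of coercivity in the
    gradient. *)
Lemma m_bounds p : 1 - sigma M <= m M p <= 1 + sigma M.
Proof.
have s0 := sigma_ge0 M; rewrite mE; set c := cos _.
have c1 : c <= 1 by exact: cos_le1.
have cN1 : -1 <= c by exact: cos_geN1.
by apply/andP; split; nra.
Qed.

(* The Chebyshev recursion sidesteps the continuity of acos at the endpoints. *)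
Lemma measurable_cos_mul_acos d (T : measurableType d) (c : T -> R) n :
  measurable_fun [set: T] c -> (forall x, c x \in `[-1, 1]) ->
  measurable_fun [set: T] (fun x => cos (n%:R * acos (c x))).
Proof.
move=> mc c1.
(* The recursion has order two, so two consecutive indices are carried through the induction. *)
suff [] : measurable_fun [set: T] (fun x => cos (n%:R * acos (c x))) /\
  measurable_fun [set: T] (fun x => cos (n.+1%:R * acos (c x))) by [].
elim: n => [|n [IH0 IH1]]; split => //.
- rewrite (_ : (fun _ => _) = fun=> 1); first exact: measurable_cst.
  by apply/funext => x; rewrite mul0r cos0.
- rewrite (_ : (fun _ => _) = c)//.
  by apply/funext => x; rewrite mul1r acosK.
- rewrite (_ : (fun _ => _) = (fun x => 2 * (c x * cos (n.+1%:R * acos (c x))))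
      \- (fun x => cos (n%:R * acos (c x)))).
    apply: measurable_funB => //.
    apply: measurable_funM; first exact: measurable_cst.
    exact: measurable_funM.
  apply/funext => x /=; set t := acos (c x).
  have ct : c x = cos t by rewrite acosK.
  have -> : n.+2%:R * t = n.+1%:R * t + t by rewrite -addn1 natrD mulrDl mul1r.
  have -> : n%:R * t = n.+1%:R * t - t.
    by rewrite -addn1 natrD mulrDl mul1r addrK.
  by rewrite cosD cosB ct; ring.
Qed.

Lemma bounded_measurable_m gx gy : bounded_measurable gx ->
  bounded_measurable gy -> bounded_measurable (fun x => m M (gx x, gy x)).
Proof.
move=> [mgx _] [mgy _]; split; last first.
  exists (1 + sigma M) => x; have /andP[lo hi] := m_bounds (gx x, gy x).
  rewrite ler_norml hi andbT (le_trans _ lo)// lerNl opprB.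
  by have := sigma_lt1 M; lra.
rewrite (_ : (fun _ => _) = fun x => 1 + sigma M *
    cos ((beta M)%:R * acos (gx x / enorm (gx x, gy x)))); last first.
  by apply/funext => x; rewrite mE.
apply: measurable_funD; first exact: measurable_cst.
apply: measurable_funM; first exact: measurable_cst.
apply: measurable_cos_mul_acos; last first.
  by move=> x; exact: (direction_cosine_itv (gx x, gy x)).
apply: measurable_funM => //.
(* The inverse length is written as a real power, whose measurability is known; at a zero gradient
   both sides are 0. *)
rewrite (_ : (fun _ => _) = fun x => (gx x ^+ 2 + gy x ^+ 2) `^ (- 2^-1)).
  apply: (measurableT_comp (measurable_powR _)).
  by apply: measurable_funD; exact: measurable_funX.
by apply/funext => x; rewrite powRN powR12_sqrt// addr_ge0// sqr_ge0.
Qed.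

Lemma bounded_measurable_F phi : bounded_measurable phi ->
  bounded_measurable (fun x => F M (phi x)).
Proof.
move=> bphi; apply: bounded_measurableM; last exact: bounded_measurable_cst.
apply: (bounded_measurableX 2); apply: bounded_measurableD.
  exact: bounded_measurableX.
exact: bounded_measurable_cst.
Qed.

Lemma F_ge0 t : 0 <= F M t.
Proof. by rewrite /F divr_ge0 ?sqr_ge0// mulr_ge0 ?ler0n ?sqr_ge0. Qed.

Definition sq_grad phi (x : R * R) : R := dx phi x ^+ 2 + dy phi x ^+ 2.

Lemma sq_grad_ge0 phi x : 0 <= sq_grad phi x.
Proof. by rewrite addr_ge0// sqr_ge0. Qed.

Lemma bounded_measurable_sq_grad phi :
  bounded_partials phi -> bounded_measurable (sq_grad phi).
Proof.
move=> /bounded_partials_grad[bx yb].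
by apply: bounded_measurableD; exact: bounded_measurableX.
Qed.

Lemma normL2v_grad_sq phi : normL2v (grad phi) ^+ 2 = integralO (sq_grad phi).
Proof.
rewrite /normL2v /normL2 sqr_sqrtr; last first.
  by apply: integralO_ge0 => x; exact: sqr_ge0.
by congr integralO; apply/funext => x; rewrite /= enorm_sq.
Qed.

Lemma normL2_sq u : normL2 u ^+ 2 = integralO (fun x => u x ^+ 2).
Proof.
by rewrite sqr_sqrtr//; apply: integralO_ge0 => x; exact: sqr_ge0.
Qed.

Lemma kinetic_density phi x :
  enorm (m M (grad phi x) *: grad phi x) ^+ 2
  = m M (dx phi x, dy phi x) ^+ 2 * sq_grad phi x.
Proof. by rewrite enorm_sq/= /GRing.scale/= !exprMn -mulrDr. Qed.

Lemma coupling_gt0 : 0 < lam M / (2 * eps M * Kc M).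
Proof.
by rewrite divr_gt0 ?lam_gt0// !mulr_gt0 ?eps_gt0 ?Kc_gt0.
Qed.

Lemma density_ge0 phi u x :
  0 <= 2^-1 * enorm (m M (grad phi x) *: grad phi x) ^+ 2
    + lam M / (2 * eps M * Kc M) * u x ^+ 2 + F M (phi x).
Proof.
rewrite !addr_ge0 ?F_ge0// mulr_ge0 ?sqr_ge0 ?invr_ge0//.
exact/ltW/coupling_gt0.
Qed.

(** The constant 1 in the energy, added to a nonnegative integral, makes division by E safe and
    later absorbs a factor [1 / E]. *)
Lemma energy_ge1 phi u : 1 <= energy M phi u.
Proof. by rewrite lerDr integralO_ge0// => x; exact: density_ge0. Qed.

Lemma bounded_measurable_density phi u :
  bounded_partials phi -> bounded_partials u ->
  bounded_measurable (fun x =>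
    2^-1 * enorm (m M (grad phi x) *: grad phi x) ^+ 2
    + lam M / (2 * eps M * Kc M) * u x ^+ 2 + F M (phi x)).
Proof.
move=> cphi cu; have [bx yb] := bounded_partials_grad _ cphi.
have [? [? [bu _ _ _ _]]] := cu; have [? [? [bphi _ _ _ _]]] := cphi.
apply: bounded_measurableD; last exact: bounded_measurable_F.
apply: bounded_measurableD; apply: bounded_measurableZ; last first.
  exact: bounded_measurableX.
rewrite (_ : (fun _ => _) =
    fun x => m M (dx phi x, dy phi x) ^+ 2 * sq_grad phi x).
  apply: bounded_measurableM; last exact: bounded_measurable_sq_grad.
  by apply: (bounded_measurableX 2); exact: bounded_measurable_m.
by apply/funext => x; exact: kinetic_density.
Qed.

(** The constant 1 and the nonnegative terms in [u] and [F] are dropped; then [m >= 1 - sigma] is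
    applied pointwise. *)
Lemma energy_ge_grad phi u : bounded_partials phi -> bounded_partials u ->
  (1 - sigma M) ^+ 2 / 2 * normL2v (grad phi) ^+ 2 <= energy M phi u.
Proof.
move=> cphi cu; rewrite normL2v_grad_sq -integralOZ; last first.
  exact: bounded_measurable_sq_grad.
rewrite (le_trans _ (ler_wpDr ler01 (lexx _)))//.
apply: integralO_le.
- by apply: bounded_measurableZ; exact: bounded_measurable_sq_grad.
- exact: bounded_measurable_density.
move=> x; rewrite kinetic_density -!addrA ler_wpDr//.
  by rewrite addr_ge0 ?F_ge0// mulr_ge0 ?sqr_ge0// ltW// coupling_gt0.
rewrite mulrA ler_wpM2r ?sq_grad_ge0// mulrC ler_wpM2l ?invr_ge0//.
have /andP[lo _] := m_bounds (dx phi x, dy phi x).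
by rewrite lerXn2r// nnegrE ?(le_trans _ lo)// subr_ge0 ltW// sigma_lt1.
Qed.

Lemma energy_ge_u phi u : bounded_partials phi -> bounded_partials u ->
  lam M / (2 * eps M * Kc M) * normL2 u ^+ 2 <= energy M phi u.
Proof.
move=> cphi cu; have [? [? [bu _ _ _ _]]] := cu.
rewrite normL2_sq -integralOZ; last exact: (bounded_measurableX 2).
rewrite (le_trans _ (ler_wpDr ler01 (lexx _)))//.
apply: integralO_le.
- by apply: bounded_measurableZ; exact: (bounded_measurableX 2).
- exact: bounded_measurable_density.
move=> x; rewrite ler_wpDr ?F_ge0// ler_wpDl//.
by rewrite mulr_ge0 ?sqr_ge0// invr_ge0.
Qed.

Lemma normL2v_grad_scale (c : R) phi : bounded_partials phi ->
  normL2v (grad (fun x => c * phi x)) ^+ 2 = c ^+ 2 * normL2v (grad phi) ^+ 2.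
Proof.
move=> cphi; apply: (etrans (normL2v_grad_sq _)).
apply/esym/(etrans (congr1 ( *%R (c ^+ 2)) (normL2v_grad_sq phi))).
rewrite -(integralOZ (c ^+ 2) _ (bounded_measurable_sq_grad _ cphi)).
apply/esym.
rewrite (_ : sq_grad (fun x => c * phi x) = fun x => c ^+ 2 * sq_grad phi x)//.
apply/funext => x; have /(congr1 (fun G => G x)) := grad_scale c _ cphi.
by rewrite /grad /sq_grad => -[-> ->]; rewrite !exprMn mulrDr.
Qed.

Lemma normL2_scale (c : R) u : bounded_partials u ->
  normL2 (fun x => c * u x) ^+ 2 = c ^+ 2 * normL2 u ^+ 2.
Proof.
move=> [? [? [bu _ _ _ _]]]; apply: (etrans (normL2_sq _)).
apply/esym/(etrans (congr1 ( *%R (c ^+ 2)) (normL2_sq u))).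
rewrite -(integralOZ (c ^+ 2) _ (bounded_measurableX 2 bu)); apply/esym.
by congr integralO; apply/funext => x; rewrite exprMn.
Qed.

(** Both terms are squares with positive weights, whatever the regularity of [flux]. *)
Lemma dissipation_ge0 phi u : 0 <= dissipation M phi u.
Proof.
rewrite addr_ge0// mulr_ge0 ?sqr_ge0 ?invr_ge0 ?ltW ?tau_gt0//.
by rewrite divr_gt0// mulr_gt0 ?lam_gt0 ?Dc_gt0 ?eps_gt0 ?Kc_gt0.
Qed.

End energy_bounds.

(** * Monotonicity of [q_] and smallness of [eta] *)

Section stability.
Context {R : realType} (M : model R) (k N : nat) (dt : R) (s : iterates R).
Context (dt0 : 0 < dt) (hs : scheme M k N dt s).

(** The dissipation terms cancel exactly, so the law holds before any sign of [q_] is known, and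
    [q_bounds] can build on it. *)
Lemma q_nonincreasing n : q_ s n.+1 <= q_ s n.
Proof.
have [_ /(_ n)[_ _ hq [_ _ _ _ hz]]] := hs; move: hz hq; rewrite /q_equation.
set r := qbar s n.+1 / _ * _; rewrite ler_pdivrMr// => hz /(congr1 ( *%R dt)).
by rewrite mulrA divff ?gt_eqF// mul1r mulNr mulrN -/r => hq; lra.
Qed.

Lemma qbar_bounds n : 0 <= q_ s n -> 0 <= qbar s n.+1 <= q_ s n.
Proof.
have [_ /(_ n)[_ _ hq _]] := hs; move: hq; rewrite /q_equation.
have E1 : 1 <= energy_bar M s n.+1 by exact: energy_ge1.
have H0 : 0 <= dissipation_bar M s n.+1 by exact: dissipation_ge0.
set E := energy_bar M s n.+1 in E1 *; set H := dissipation_bar M s n.+1 in H0 *.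
have E0 : 0 < E by rewrite (lt_le_trans ltr01).
move=> /(congr1 ( *%R dt)); rewrite mulrA divff ?gt_eqF// mul1r => hq q0.
have D0 : 0 <= dt * H / E by rewrite divr_ge0 ?mulr_ge0// ltW.
(* The factor is at least 1 for every positive [dt], which gives both bounds without restricting the
   time step. *)
have {}hq : qbar s n.+1 * (1 + dt * H / E) = q_ s n.
  by rewrite -[RHS](subKr (qbar s n.+1)) hq; ring.
have q'0 : 0 <= qbar s n.+1.
  by rewrite -(pmulr_lge0 _ (_ : 0 < 1 + dt * H / E)) ?hq// ltr_pwDl.
by rewrite q'0/= -hq ler_peMr// lerDl.
Qed.

(** Nonnegativity survives the correction because [q_ s n.+1] is a convex combination of
    [qbar s n.+1 >= 0] and an energy. *)
Lemma q_bounds n : 0 <= q_ s n <= q_ s 0.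
Proof.
elim: n => [|n /andP[q0 qle]].
  have [[_ ->] _] := hs; rewrite lexx andbT.
  by rewrite (le_trans ler01)// energy_ge1.
rewrite (le_trans (q_nonincreasing n) qle) andbT.
have /andP[qb0 _] := qbar_bounds _ q0.
have [_ /(_ n)[_ _ _ [_ _ -> /andP[z0 z1] _]]] := hs.
rewrite addr_ge0 ?mulr_ge0 ?subr_ge0//.
by rewrite (le_trans ler01)// energy_ge1.
Qed.

Lemma eta_bound n :
  `|eta M k s n.+1|
  <= k.+1%:R * (1 + q_ s 0) ^+ k * q_ s 0 / energy_bar M s n.+1.
Proof.
have /andP[q0 qle] := q_bounds n; have /andP[qb0 qb1] := qbar_bounds _ q0.
have E1 : 1 <= energy_bar M s n.+1 by exact: energy_ge1.
have E0 : 0 < energy_bar M s n.+1 by rewrite (lt_le_trans ltr01).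
have xi0 : 0 <= xi M s n.+1 by rewrite divr_ge0// ltW.
have xi1 : xi M s n.+1 <= q_ s 0 / energy_bar M s n.+1.
  by rewrite ler_pM2r ?invr_gt0// (le_trans qb1).
have xi2 : xi M s n.+1 <= q_ s 0.
  by rewrite (le_trans xi1)// ler_pdivrMr// ler_peMr// (le_trans q0).
(* Geometric sum: with [x = 1 - xi], [x^(k+1) - 1] is [- xi] times the sum of [x^i] for [i <= k].
   The factor [xi] supplies [q_ s 0 / E], and the sum is bounded termwise. *)
rewrite /eta -opprB normrN subrX1 addrAC subrr sub0r normrM normrN.
rewrite (ger0_norm xi0).
rewrite -mulrA mulrC ler_pM//.
rewrite (le_trans (ler_norm_sum _ _ _))// mulr_natl.
rewrite -[k.+1 in leRHS]card_ord -sumr_const.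
apply: ler_sum => i _; rewrite normrX.
have le1 : `|1 - xi M s n.+1| <= 1 + q_ s 0.
  by rewrite (le_trans (ler_normB _ _))// normr1 ger0_norm// lerD2l.
apply: (@le_trans _ _ ((1 + q_ s 0) ^+ i)).
  by rewrite lerXn2r// nnegrE (le_trans _ le1).
(* The base is at least 1 and [i <= k], so each of the [k + 1] powers is at most the [k]-th. *)
by rewrite ler_weXn2l// ?lerDl ?(le_trans q0)// -ltnS.
Qed.

End stability.

(** The square of [c] contributes [E^-2] and that of [X] at most [E / b]; the remaining [1 / E] is
    at most 1, so the bound is free of E. *)
Lemma scaled_bound {R : realType} (A E b c X : R) : 1 <= E -> 0 < b ->
  `|c| <= A / E -> b * X ^+ 2 <= E -> c ^+ 2 * X ^+ 2 <= A ^+ 2 / b.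
Proof.
move=> E1 b0 cA bX; have E0 : 0 < E by rewrite (lt_le_trans ltr01).
have A0 : 0 <= A.
  by rewrite -(pmulr_lge0 _ (_ : 0 < E^-1)) ?invr_gt0// (le_trans _ cA).
have cA2 : c ^+ 2 <= (A / E) ^+ 2.
  by rewrite -real_normK ?num_real// lerXn2r// nnegrE ?divr_ge0// ltW.
have XE : X ^+ 2 <= E / b by rewrite ler_pdivlMr// mulrC.
rewrite (le_trans (ler_pM _ _ cA2 XE)) ?sqr_ge0//.
rewrite (_ : (A / E) ^+ 2 * (E / b) = A ^+ 2 / b / E); last first.
  by field; rewrite !gt_eqF.
by rewrite ler_pdivrMr// ler_peMr// divr_ge0 ?sqr_ge0// ltW.
Qed.

Theorem theorem3p2 (R : realType) (M : model R) (k N : nat)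
    (hk : (1 <= k <= 3)%N) (hN : (0 < N)%N) :
  (forall (dt : R) (s : iterates R), 0 < dt -> scheme M k N dt s ->
     forall n : nat, q_ s n.+1 <= q_ s n)
  /\
  (forall phi0 u0 : R * R -> R, trig_poly N phi0 -> trig_poly N u0 ->
     exists C : R, forall (dt : R) (s : iterates R),
       0 < dt -> scheme M k N dt s ->
       phi_ s 0 = phi0 -> u_ s 0 = u0 ->
       forall n : nat,
         normL2v (grad (phi_ s n%:Z)) <= C /\ normL2 (u_ s n%:Z) <= C).
Proof.
split=> [dt s dt0 hs n|phi0 u0 _ _]; first exact: q_nonincreasing dt0 hs n.
pose q0 := energy M phi0 u0.
(* This is the constant of [eta_bound], with [q_ s 0] replaced by the initial energy: it is fixed
   before [dt] and the iterates. *)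
pose A := k.+1%:R * (1 + q0) ^+ k * q0.
pose b1 := (1 - sigma M) ^+ 2 / 2.
pose b2 := lam M / (2 * eps M * Kc M).
have b1_gt0 : 0 < b1 by rewrite divr_gt0 ?exprn_gt0 ?subr_gt0 ?sigma_lt1.
have b2_gt0 : 0 < b2 by exact: coupling_gt0.
(* The inner maximum of initial norms covers [n = 0], where no factor [eta] is present; the square
   roots come from [scaled_bound] with the coercivity constants [b1] and [b2]. *)
exists (Num.max (Num.max (normL2v (grad phi0)) (normL2 u0))
          (Num.max (Num.sqrt (A ^+ 2 / b1)) (Num.sqrt (A ^+ 2 / b2)))).
move=> dt s dt0 hs hphi hu [|n]; first by rewrite hphi hu !le_max !lexx !orbT.
have [[_ hq0] /(_ n)[[hphibar _] [hubar _] _ [phiE uE _ _ _]]] := hs.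
have cphi := has_coefs_bounded_partials _ _ _ hphibar.
have cu := has_coefs_bounded_partials _ _ _ hubar.
have etaA := eta_bound M k N dt s dt0 hs n.
rewrite hq0 hphi hu -/q0 -/A in etaA.
have E1 : 1 <= energy_bar M s n.+1 by exact: energy_ge1.
have sqrt_bound (x y : R) : x ^+ 2 <= y -> x <= Num.sqrt y.
  by move=> xy; rewrite (le_trans (ler_norm x))// -sqrtr_sqr ler_wsqrtr.
have -> : phi_ s n.+1%:Z = fun x => eta M k s n.+1 * phibar s n.+1 x.
  exact/funext.
have -> : u_ s n.+1%:Z = fun x => eta M k s n.+1 * ubar s n.+1 x.
  exact/funext.
split.
- rewrite !le_max; apply/orP; right; apply/orP; left; apply: sqrt_bound.
  rewrite normL2v_grad_scale//; apply: scaled_bound E1 b1_gt0 etaA _.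
  exact: energy_ge_grad.
- rewrite !le_max; apply/orP; right; apply/orP; right; apply: sqrt_bound.
  rewrite normL2_scale//; apply: scaled_bound E1 b2_gt0 etaA _.
  exact: energy_ge_u.
Qed.
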